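(* Let $\mathcal{I}$ be a nontrivial admissible ideal of subsets of $\mathbb{N}$. The topological space $(\mathbb{R},\mathfrak{T}_{\mathcal{I}})$ is completely regular.
   Context: $m$ denotes Lebesgue measure on $\mathbb{R}$. An ideal $\mathcal{I}$ of subsets of $\mathbb{N}=\{1,2,\dots\}$ is a nonempty family closed under finite unions and under subsets; it is nontrivial if $\mathcal{I}\neq\{\emptyset\}$ and $\mathbb{N}\notin\mathcal{I}$, and admissible if it contains all singletons. $\mathcal{F}(\mathcal{I})=\{M\subset\mathbb{N}:\mathbb{N}\setminus M\in\mathcal{I}\}$. For a bounded real sequence $x=(x_n)$: $\mathcal{I}\text{-}\liminf x=\inf\{a\in\mathbb{R}:\{k:x_k<a\}\notin\mathcal{I}\}$. Let $E\subset\mathbb{R}$ be Lebesgue measurable and $p\in\mathbb{R}$. Consider sequences $(J_n)_{n\in\mathbb{N}}$ of closed intervals with $p\in J_n$ for all $n$ and $\{n\in\mathbb{N}:0<m(J_n)<\frac1n\}\in\mathcal{F}(\mathcal{I})$. For such a sequence put $x_n=\frac{m(J_n\cap E)}{m(J_n)}$ (with $x_n:=0$ if $m(J_n)\in\{0,\infty\}$; such $n$ form a set in $\mathcal{I}$ and do not matter). The lower $\mathcal{I}$-density $\mathcal{I}\text{-}d_-(p,E)$ is the infimum of $\mathcal{I}\text{-}\liminf x_n$ over all such sequences $(J_n)$. $\mathfrak{T}_{\mathcal{I}}$ (the $\mathcal{I}$-density topology on $\mathbb{R}$) is the collection of Lebesgue measurable sets $A\subset\mathbb{R}$ with $\mathcal{I}\text{-}d_-(x,A)=1$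 for all $x\in A$; it is a topology. Completely regular: for every $\mathfrak{T}_{\mathcal{I}}$-closed set $F$ and point $p_0\notin F$ there is a continuous function $g:(\mathbb{R},\mathfrak{T}_{\mathcal{I}})\to[0,1]$ (usual topology on $[0,1]$) with $g=0$ on $F$ and $g(p_0)=1$. *)

(* Defs.v *)
From HB Require Import structures.
From mathcomp Require Import all_boot all_order all_algebra.
From mathcomp Require Import all_classical all_reals all_analysis.
From mathcomp Require Import ring lra.

Set Implicit Arguments.
Unset Strict Implicit.
Unset Printing Implicit Defensive.
Import Order.TTheory GRing.Theory Num.Theory.
Import numFieldNormedType.Exports.
Local Open Scope classical_set_scope.
Local Open Scope ring_scope.

(* Families of subsets of {1, 2, ...}.  The element k : nat encodes the
   positive integer k.+1, so that 1/n becomes k.+1%:R^-1. *)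

Record is_ideal (I : set_system nat) : Prop := IsIdeal {
  ideal_nonempty : I !=set0;
  idealU : forall A B, I A -> I B -> I (A `|` B);
  idealS : forall A B, A `<=` B -> I B -> I A }.

Definition nontrivial (I : set_system nat) : Prop :=
  I <> [set set0] /\ ~ I [set: nat].

Definition admissible (I : set_system nat) : Prop :=
  forall k, I [set k].

Definition dual_filter (I : set_system nat) : set_system nat :=
  [set M | I (~` M)].

Definition I_liminf (R : realType) (I : set_system nat) (x : nat -> R) : R :=
  inf [set a : R | ~ I [set k | x k < a]].

(* The Lebesgue sigma-algebra, i.e. the completion of the Borel sets
   (see completed_caratheodory_measurable). *)
Definition lebesgue_measurable (R : realType) (A : set R) : Prop :=
  ((wlength (@idfun R))^*)%mu.-cara.-measurable A.

Definition leb (R : realType) (A : set R) : \bar R :=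
  completed_lebesgue_measure A.

Section lower_density.
Context (R : realType).
Implicit Types (I : set_system nat) (p : R) (E : set R) (J : nat -> set R).

(* Degenerate and unbounded closed intervals are allowed. *)
Definition shrinking_to I p J : Prop :=
  (forall k, [/\ closed (J k), is_interval (J k) & J k p]) /\
  dual_filter I [set k | (0 < leb (J k) < (k.+1%:R^-1)%:E)%E].

(* When leb (J k) is 0 or +oo the denominator is 0, hence so is the ratio. *)
Definition density_ratio J E (k : nat) : R :=
  fine (leb (J k `&` E)) / fine (leb (J k)).

Definition lower_density I p E : R :=
  inf [set I_liminf I (density_ratio J E) | J in shrinking_to I p].

Definition density_open I : set_system R :=
  [set A | lebesgue_measurable A /\
           forall x, A x -> lower_density I x A = 1].

End lower_density.
Arguments density_open : clear implicits.

Section density_topology.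
Context (R : realType) (I : set_system nat).
Hypotheses (idI : is_ideal I) (ntI : nontrivial I) (adI : admissible I).
Implicit Types (x p a : R) (A B E F : set R) (J : nat -> set R).

Let I0 : I set0.
Proof. by have [A IA] := ideal_nonempty idI; exact: (idealS idI) IA. Qed.

Let IT : ~ I [set: nat]. Proof. by case: ntI. Qed.

Let I_fin n : I [set k | (k < n)%N].
Proof.
elim: n => [|n IHn]; first by apply: (idealS idI) I0.
apply: (idealS idI) (idealU idI IHn (adI n)) => k /=.
by rewrite ltnS leq_eqVlt => /orP[/eqP ->|]; [right|left].
Qed.

Let om : {outer_measure set (ocitv_type R) -> \bar R} :=
  ((wlength (@idfun R))^*)%mu.

Let leb_ge0 A : (0 <= leb A)%E.
Proof. exact: (@outer_measure_ge0 _ _ om A). Qed.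

Let le_leb A B : A `<=` B -> (leb A <= leb B)%E.
Proof. exact: (@le_outer_measure _ _ om A B). Qed.

Let borel_lebesgue A : measurable A -> lebesgue_measurable A.
Proof. exact: sub_caratheodory. Qed.

Let lebesgue_measurableI A B :
  lebesgue_measurable A -> lebesgue_measurable B -> lebesgue_measurable (A `&` B).
Proof. exact: measurableI. Qed.

Let lebesgue_measurableD A B :
  lebesgue_measurable A -> lebesgue_measurable B -> lebesgue_measurable (A `\` B).
Proof. exact: measurableD. Qed.

Let lebesgue_measurableU A B :
  lebesgue_measurable A -> lebesgue_measurable B -> lebesgue_measurable (A `|` B).
Proof. exact: measurableU. Qed.

Let leb_ltoo A B : A `<=` B -> (leb B < +oo)%E -> leb A \is a fin_num.
Proof. by move=> AB Boo; rewrite ge0_fin_numE// (le_lt_trans _ Boo)// le_leb. Qed.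

Let lebDI A B : lebesgue_measurable A -> 
   leb B = (leb (B `&` A) + leb (B `&` ~` A))%E.
Proof. exact. Qed.

Let ratio_ge0 J E k : 0 <= density_ratio J E k.
Proof. by rewrite divr_ge0// fine_ge0. Qed.

Let ratio_le1 J E k : density_ratio J E k <= 1.
Proof.
rewrite /density_ratio.
have [->|J0] := eqVneq (fine (leb (J k))) 0; first by rewrite invr0 mulr0.
have Joo : (leb (J k) < +oo)%E by case: (leb (J k)) J0 => [r||]//=; rewrite ?eqxx// ltry.
rewrite ler_pdivrMr ?mul1r; last by rewrite lt_neqAle eq_sym J0 fine_ge0.
by rewrite fine_le// ?(leb_ltoo _ Joo)//; apply: le_leb; exact: subIsetl.
Qed.

Let I_liminf_ge (u : nat -> R) c : (forall k, 0 <= u k <= 1) ->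
  (forall a, a < c -> I [set k | u k < a]) -> c <= I_liminf I u.
Proof.
move=> u01 Iu; apply: lb_le_inf.
  exists 2 => /= h; apply: IT; apply: (idealS idI) h => k _ /=.
  by have /andP[_ /le_lt_trans] := u01 k; apply; rewrite ltr1n.
by move=> a /= nIa; rewrite leNgt; apply/negP => /Iu.
Qed.

Let liminf_has_lb (u : nat -> R) : (forall k, 0 <= u k <= 1) ->
  has_lbound [set a : R | ~ I [set k | u k < a]].
Proof.
move=> u01; exists 0 => a /= nIa; rewrite leNgt; apply/negP => a0.
apply: nIa; apply: (idealS idI) I0 => k /= ua.
by have /andP[/le_lt_trans /(_ ua) /lt_trans /(_ a0)] := u01 k; rewrite ltxx.
Qed.

Let I_liminf_le1 (u : nat -> R) : (forall k, 0 <= u k <= 1) ->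
  I_liminf I u <= 1.
Proof.
move=> u01; apply/ler_addgt0Pl => e e0; apply: ge_inf; first exact: liminf_has_lb.
move=> /= h; apply: IT; apply: (idealS idI) h => k _ /=.
by have /andP[_ /le_lt_trans] := u01 k; apply; rewrite ltrDr.
Qed.

Let ballJ x (k : nat) : set R :=
  closed_ball x (4^-1 * k.+1%:R^-1).

Let rk_gt0 (k : nat) : 0 < 4^-1 * k.+1%:R^-1 :> R.
Proof. by rewrite mulr_gt0// invr_gt0. Qed.

Let leb_ballJ x k : leb (ballJ x k) = (2^-1 * k.+1%:R^-1)%:E.
Proof.
rewrite [LHS](lebesgue_measure_closed_ball x (ltW (rk_gt0 k))).
by congr (_%:E); move: (k.+1%:R^-1) => c; lra.
Qed.

Let ballJ_shrinking x : shrinking_to I x (ballJ x).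
Proof.
split=> [k|].
  split; first exact: closed_ball_closed.
    by rewrite /ballJ closed_ball_itv//; exact: interval_is_interval.
  exact: closed_ballxx.
apply: (idealS idI) I0 => k /=; apply.
rewrite leb_ballJ !lte_fin mulr_gt0 ?invr_gt0//=.
by rewrite gtr_pMl ?invr_gt0// invf_lt1// ltr1n.
Qed.

Let ratio01 J E k : 0 <= density_ratio J E k <= 1.
Proof. by rewrite ratio_ge0 ratio_le1. Qed.

Lemma lower_density1P x E : lower_density I x E = 1 <->
  forall J, shrinking_to I x J -> forall a, a < 1 ->
    I [set k | density_ratio J E k < a].
Proof.
have lb0 : lbound [set I_liminf I (density_ratio J E) | J in shrinking_to I x] 0.
  move=> _ [J xJ <-]; apply: I_liminf_ge => // a a0.
  apply: (idealS idI) I0 => k /= h.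
  by have := lt_trans h a0; rewrite ltNge ratio_ge0.
split=> [d1 J xJ a a1|h].
- apply: contrapT => nIa.
  have : 1 <= I_liminf I (density_ratio J E).
    by rewrite -d1; apply: ge_inf; [exists 0|exists J].
  apply/negP; rewrite -ltNge (le_lt_trans _ a1)//.
  by apply: ge_inf => //; exact: liminf_has_lb.
- apply/eqP; rewrite eq_le; apply/andP; split.
    apply: (@le_trans _ _ (I_liminf I (density_ratio (ballJ x) E))); last exact: I_liminf_le1.
    by apply: ge_inf; [exists 0|exists (ballJ x)].
  apply: lb_le_inf.
    by exists (I_liminf I (density_ratio (ballJ x) E)); exists (ballJ x).
  by move=> _ [J xJ <-]; apply: I_liminf_ge => // a; exact: h.
Qed.

Let fin_good J k : (0 < leb (J k) < (k.+1%:R^-1)%:E)%E ->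
  leb (J k) \is a fin_num /\ 0 < fine (leb (J k)).
Proof.
move=> /andP[J0 J1]; have Joo := lt_trans J1 (ltry _).
by split; [rewrite ge0_fin_numE|rewrite fine_gt0// J0 Joo].
Qed.

Lemma density_openT : density_open R I [set: R].
Proof.
split=> [|x _]; first exact: measurableT.
apply/lower_density1P => J [_ IJ] a a1; apply: (idealS idI) IJ => k /= ka good.
move: ka; rewrite /density_ratio setIT divff ?ltNge ?(ltW a1)//.
by have [_ /gt_eqF ->] := fin_good good.
Qed.

Lemma density_openI : setI_closed (density_open R I).
Proof.
move=> A B [mA dA] [mB dB]; split; first exact: lebesgue_measurableI.
move=> x [Ax Bx]; apply/lower_density1P => J xJ a a1.
have b1 : (1 + a) / 2 < 1 by lra.
have IA := (lower_density1P x A).1 (dA x Ax) J xJ _ b1.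
have IB := (lower_density1P x B).1 (dB x Bx) J xJ _ b1.
apply: (idealS idI) (idealU idI (idealU idI IA IB) xJ.2) => k /= ka.
apply: contrapT => /not_orP[/not_orP[/negP hA /negP hB]] /contrapT good.
have [Jfin J0] := fin_good good.
have Joo : (leb (J k) < +oo)%E by rewrite -ge0_fin_numE.
have Jf C : leb (J k `&` C) \is a fin_num by apply: leb_ltoo Joo; exact: subIsetl.
have le1 : fine (leb (J k `&` A)) <=
    fine (leb (J k `&` (A `&` B))) + fine (leb (J k `&` ~` B)).
  rewrite -fineD// fine_le ?fin_numD ?Jf// (lebDI (J k `&` A) mB).
  by rewrite leeD ?le_leb// => [|y [[]]]//; rewrite setIA.
have le2 : fine (leb (J k)) = fine (leb (J k `&` B)) + fine (leb (J k `&` ~` B)).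
  by rewrite -fineD ?Jf// -lebDI.
move: ka hA hB; rewrite /density_ratio -!leNgt.
rewrite ltr_pdivrMr// !ler_pdivlMr//.
move: le1 le2 J0.
move: (fine _) (fine _) (fine _) (fine _) (fine _) => *.
nra.
Qed.

Let outer_hull E : (leb E < +oo)%E ->
  exists B : set R, [/\ measurable B, E `<=` B & leb B = leb E].
Proof.
move=> Eoo.
have coverE (s : R) : 0 < s ->
   exists2 A, @measurable_cover _ (ocitv_type R) E A &
   (\sum_(0 <= k <oo) (wlength (@idfun R)) (A k) < leb E + s%:E)%E.
  move=> s0; have : leb E \is a fin_num by rewrite ge0_fin_numE.
  by move/lb_ereal_inf_adherent => /(_ _ s0)[_/= [A EA] <-] ?; exists A.
have inv0 n : 0 < n.+1%:R^-1 :> R by rewrite invr_gt0.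
pose A n := projT1 (cid2 (coverE _ (inv0 n))).
have mA k : @measurable_cover _ (ocitv_type R) E (A k).
  by rewrite /A; case: cid2.
have mA_E n : (\sum_(0 <= k <oo) (wlength (@idfun R)) (A n k) < leb E + n.+1%:R^-1%:E)%E.
  by rewrite /A; case: cid2.
pose F_ n := \bigcup_m (A n m).
have EF_n n : E `<=` F_ n.
  have [/= _] := mA n.
  by move=> /subset_trans; apply; apply: subset_bigcup => i _.
have mF_ m : (leb (F_ m) < leb E + m.+1%:R^-1%:E)%E.
  apply: (le_lt_trans _ (mA_E m)).
  apply: (le_trans (@outer_measure_sigma_subadditive _ _ om (A m))).
  apply: lee_nneseries => // n _.
  by rewrite -((measurable_mu_extE (wlength (@idfun R))) (A m n))//; have [/(_ n)] := mA m.
pose F := \bigcap_n (F_ n).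
exists F; split.
- apply: bigcapT_measurable => k; apply: bigcupT_measurable => i.
  apply: sub_sigma_algebra; have [mAk _] := mA k; exact: (mAk i).
- exact: sub_bigcap.
- apply/eqP; rewrite eq_le; apply/andP; split; last first.
    by apply: le_leb; exact: sub_bigcap.
  apply/lee_addgt0Pr => /= _/posnumP[e]; near \oo => n.
  apply: (@le_trans _ _ (leb (F_ n))).
    by apply: le_leb; exact: bigcap_inf.
  rewrite (le_trans (ltW (mF_ n)))// leeD// lee_fin ltW//.
  by near: n; apply: near_infty_natSinv_lt.
Unshelve. all: by end_near. Qed.


Let density_meet A B x : density_open R I A -> A x ->
  (leb (B `&` ball x r) / leb (ball x r))%E @[r --> 0^'+] --> (1%:E : \bar R) ->
  leb (B `&` A) <> 0%E.
Proof.
move=> [mA dA] Ax Bx AB0.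
have I1 := (lower_density1P x A).1 (dA x Ax) _ (ballJ_shrinking x) 2^-1.
have {}I1 := I1 (ltac:(lra) : 2^-1 < 1 :> R).
pose rk k : R := 4^-1 * k.+1%:R^-1.
have rk0 : rk k @[k --> \oo] --> (0 : R).
  by rewrite -(mulr0 4^-1); apply: cvgMr; exact: cvg_harmonic.
pose g r := fine (leb (B `&` ball x r) / leb (ball x r)).
have g1 : g r @[r --> 0^'+] --> (1 : R) by exact: (fine_cvg Bx).
have gk : g (rk k) @[k --> \oo] --> (1 : R).
  have [+ _] := cvg_at_rightP g 0 1.
  by move=> /(_ g1 rk); apply; split=> // k; exact: rk_gt0.
have [N _ HN] : \forall k \near \oo, 2^-1 < g (rk k).
  by apply: (cvgr_gt _ gk); lra.
apply: IT; apply: (idealS idI) (idealU idI I1 (I_fin N)) => k _ /=.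
rewrite ltnNge; case: (leqP N k) => [Nk|]; last by right.
left.
have := HN k Nk; rewrite /g /=.
have J2 := leb_ballJ x k.
have b2 : leb (ball x (rk k)) = (2^-1 * k.+1%:R^-1)%:E.
  rewrite [LHS](lebesgue_measure_ball x (ltW (rk_gt0 k))).
  by congr (_%:E); move: (k.+1%:R^-1) => c; lra.
have c0 : 0 < k.+1%:R^-1 :> R by rewrite invr_gt0.
have Joo : (leb (ballJ x k) < +oo)%E by rewrite J2 ltry.
have Jf C : leb (ballJ x k `&` C) \is a fin_num by apply: leb_ltoo Joo; exact: subIsetl.
have bJ : ball x (rk k) `<=` ballJ x k by exact: subset_closed_ball.
have BJ : (leb (B `&` ball x (rk k)) <= leb (ballJ x k `&` ~` A))%E.
  rewrite (lebDI (B `&` ball x (rk k)) mA).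
  have -> : leb (B `&` ball x (rk k) `&` A) = 0%E.
    by apply/eqP; rewrite eq_le leb_ge0 andbT -AB0 le_leb// => y [[]].
  by rewrite add0e le_leb// => y [[_ /bJ]].
have Bf : leb (B `&` ball x (rk k)) \is a fin_num.
  by apply: leb_ltoo Joo => y [_ /bJ].
have := lebDI (ballJ x k) mA.
rewrite b2 inver gt_eqF ?mulr_gt0 ?invr_gt0// -(fineK Bf) -EFinM /=.
rewrite J2 -(fineK (Jf A)) -(fineK (Jf (~` A))) -EFinD => -[E1].
rewrite ltr_pdivlMr ?mulr_gt0 ?invr_gt0// => h.
have {}BJ := fine_le Bf (Jf _) BJ.
rewrite /density_ratio J2 /= ltr_pdivrMr ?mulr_gt0 ?invr_gt0//.
move: E1 h BJ c0; move: (k.+1%:R^-1) => c.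
move: (fine _) (fine _) (fine _) => *.
lra.
Qed.

Let bigcup_measurable_finite (T : Type) (f : T -> set R) (D : set R) :
  (forall i, density_open R I (f i)) -> measurable D -> (leb D < +oo)%E ->
  lebesgue_measurable (\bigcup_i f i `&` D).
Proof.
move=> fo mD Doo; set E := \bigcup_i f i.
have CD : D `\` E `<=` D by exact: subDsetl.
have Coo : (leb (D `\` E) < +oo)%E by rewrite (le_lt_trans _ Doo)// le_leb.
have [B [mB CB lebB]] := outer_hull Coo.
have Bfi i : leb (B `&` f i) = 0%E.
  have Boo : (leb B < +oo)%E by rewrite lebB.
  have Bf C : leb (B `&` C) \is a fin_num by apply: leb_ltoo Boo; exact: subIsetl.
  have : (leb B <= leb (B `&` ~` f i))%E.
    rewrite lebB le_leb// => y Cy; split; first exact: CB.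
    by move=> fiy; apply: Cy.2; exists i.
  rewrite (lebDI B (fo i).1) -(fineK (Bf (f i))) -(fineK (Bf (~` f i))).
  rewrite -EFinD lee_fin => h; congr (_%:E); apply/eqP.
  by rewrite eq_le fine_ge0// andbT; lra.
have [Z [mZ Z0 BZ]] := lebesgue_density mB.
have mN : lebesgue_measurable (B `&` E).
  apply: (@completed_lebesgue_measure_is_complete R); exists Z; split => //.
    exact: borel_lebesgue.
  move=> x [Bx [i _ fix_]]; apply: BZ => /= h.
  apply: (density_meet (fo i) fix_ _ (Bfi i)).
  by move: h; rewrite indicE mem_set.
have -> : E `&` D = (D `\` B) `|` (B `&` E) `&` D.
  apply/seteqP; split => y /=.
    move=> [Ey Dy]; have [By|nBy] := pselect (B y); first by right.
    by left.
  case=> [[Dy nBy]|[[]]//]; split=> //.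
  by apply: contrapT => nEy; apply: nBy; exact: CB.
apply: lebesgue_measurableU.
  by apply: lebesgue_measurableD; exact: borel_lebesgue.
by apply: lebesgue_measurableI => //; exact: borel_lebesgue.
Qed.

Lemma density_open_bigU (T : Type) (f : T -> set R) :
  (forall i, density_open R I (f i)) -> density_open R I (\bigcup_i f i).
Proof.
move=> fo; split.
  set E := \bigcup_i f i.
  have -> : E = \bigcup_n (E `&` ball 0 n%:R).
    apply/seteqP; split=> y [].
      move=> i _ fiy; exists (Num.bound `|y|) => //; split; first by exists i.
      rewrite /ball /= sub0r normrN.
      exact: (archi_boundP (normr_ge0 y)).
    by move=> n _ [].
  apply: (@bigcup_measurable _ (caratheodory_type om)) => n _.
  apply: bigcup_measurable_finite => //.
    by rewrite ball_itv; exact: measurable_itv.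
  by rewrite [leb _](lebesgue_measure_ball (0 : R) (ler0n _ n)) ltry.
move=> x [i _ fix_]; apply/lower_density1P => J xJ a a1.
have Ii := (lower_density1P x (f i)).1 ((fo i).2 x fix_) J xJ a a1.
apply: (idealS idI) (idealU idI Ii xJ.2) => k /= ka.
apply: contrapT => /not_orP[/negP hA] /contrapT good.
have [Jfin J0] := fin_good good.
have Joo : (leb (J k) < +oo)%E by rewrite -ge0_fin_numE.
have Jf C : leb (J k `&` C) \is a fin_num by apply: leb_ltoo Joo; exact: subIsetl.
move: hA => /negP; apply; apply: le_lt_trans ka.
rewrite /density_ratio ler_pM2r ?invr_gt0//.
rewrite fine_le ?Jf//; apply: le_leb; apply: setIS => y fiy.
by exists i.
Qed.

(* The hypotheses on I are what makes density_open R I a topology. *)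
Definition density_space (idI : is_ideal I) (ntI : nontrivial I)
  (adI : admissible I) : Type := R.

HB.instance Definition _ := Choice.copy (density_space idI ntI adI) R.
HB.instance Definition _ := isOpenTopological.Build
  (density_space idI ntI adI) density_openT density_openI density_open_bigU.

Lemma density_space_openE :
  open = density_open R I :> set_system (density_space idI ntI adI).
Proof. by []. Qed.

End density_topology.
Arguments density_space R {I} idI ntI adI.

(* The usual function-based definition; completely_regular_space of the library
   is phrased with uniform separators instead. *)
Definition completely_regular (R : realType) (T : topologicalType) : Prop :=
  forall (F : set T) (p0 : T), closed F -> ~ F p0 ->
    exists g : T -> R, [/\ continuous g,
      (forall x, 0 <= g x <= 1),
      (forall x, F x -> g x = 0) &
      g p0 = 1].

(* Main.v *)
Require Import Defs.
From mathcomp Require Import all_boot all_order all_algebra.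
From mathcomp Require Import all_classical all_reals all_analysis.
From mathcomp Require Import measurable_realfun ring lra.

Set Implicit Arguments.
Unset Strict Implicit.
Unset Printing Implicit Defensive.
Import Order.TTheory GRing.Theory Num.Theory.
Import numFieldNormedType.Exports.
Local Open Scope classical_set_scope.
Local Open Scope ring_scope.

(** All nontrivial admissible ideals give the same topology, that of the
    classical Lebesgue density: a measurable set has lower I-density 1 at [x]
    exactly when it has ordinary Lebesgue density 1 there
    ([lower_density1_density_point]).  If the ordinary density fails, the
    failure is witnessed by arbitrarily short intervals, and choosing the k-th
    one shorter than 1/(k+1) gives an admissible sequence whose ratios are all
    bounded away from 1, while the whole index set is not in the ideal.
    Conversely the indices at which an admissible sequence is not yet short
    enough form a finite set together with a member of the ideal.  So the
    theorem is the complete regularity of the classical density topology.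

    Euclidean bump functions are of no use there, since a density-open set may
    have empty Euclidean interior.  Instead one runs Urysohn's construction
    with the relation [well_inside X Y]: both sets are Euclidean closed,
    [X `<=` Y], and every point of [X] is a density point of [Y].  This relation
    can be interpolated ([well_inside_interpolation]) when [Y] is bounded: by
    Lebesgue's theorem, the points of [Y] at which [Y] has density 1 include a
    Borel set [E] that contains [X] and almost all of [Y], and the
    Lusin-Menchoff theorem ([lusin_menchoff]) inserts a closed set [P] between
    [X] and [E] that still has density 1 at the points of [X].

    The Lusin-Menchoff theorem also gives a first closed set [P] with
    [well_inside [set p0] P], contained in the given density-open
    neighbourhood of [p0].  Repeated interpolation between the two produces a
    chain [F n k], indexed by the dyadic numbers k / 2^n, which decreases as
    k / 2^n grows, and the separating function is the supremum of the k / 2^n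
    with [F n k x].  Its lower level sets are Euclidean open because the [F n k] are closed; its
    upper level sets are countable unions of the [F n k], hence Borel, and have
    density 1 at each of their points because of [well_inside].  So both are
    open in the density topology, that is, the function is continuous. *)

(** * Lebesgue outer measure *)

Lemma le_leb (R : realType) (A B : set R) : A `<=` B -> (leb A <= leb B)%E.
Proof. exact: (@le_outer_measure _ _ (wlength (@idfun R))^*%mu A B). Qed.

Lemma leb_ge0 (R : realType) (A : set R) : (0 <= leb A)%E.
Proof. exact: (@outer_measure_ge0 _ _ (wlength (@idfun R))^*%mu A). Qed.

Lemma lebU2 (R : realType) (A B : set R) : (leb (A `|` B) <= leb A + leb B)%E.
Proof. exact: (outer_measureU2 (wlength (@idfun R))^*%mu A B). Qed.

Lemma leb_splitID (R : realType) (A B : set R) : lebesgue_measurable A ->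
  leb B = (leb (B `&` A) + leb (B `\` A))%E.
Proof. by move=> mA; rewrite setDE; exact: (mA B). Qed.

Lemma leb_sub_finite (R : realType) (A B : set R) : A `<=` B ->
  (leb B < +oo)%E -> leb A \is a fin_num.
Proof.
by move=> AB Boo; rewrite ge0_fin_numE ?leb_ge0// (le_lt_trans (le_leb AB) Boo).
Qed.

Lemma leb_itvcc (R : realType) (a b : R) : a <= b ->
  leb [set` `[a, b]] = (b - a)%:E.
Proof.
move=> ab; rewrite [LHS](lebesgue_measure_itv `[a, b]) /=.
rewrite lte_fin; case: ltP => // ba.
by have -> : a = b; [apply: le_anti; rewrite ab ba|rewrite subrr].
Qed.

Lemma borel_lebesgue_measurable (R : realType) (A : set R) :
  measurable A -> lebesgue_measurable A.
Proof. exact: sub_caratheodory. Qed.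

Lemma leb_splitID_fine (R : realType) (A J : set R) (h : R) :
  lebesgue_measurable A -> leb J = h%:E ->
  exists r s, [/\ leb (J `&` A) = r%:E, leb (J `\` A) = s%:E & r + s = h].
Proof.
move=> mA Jh; have Joo : (leb J < +oo)%E by rewrite Jh ltry.
exists (fine (leb (J `&` A))), (fine (leb (J `\` A))).
have fI := leb_sub_finite (@subIsetl _ J A) Joo.
have fD := leb_sub_finite (@subDsetl _ J A) Joo.
split; rewrite ?fineK//; apply/EFin_inj.
by rewrite EFinD !fineK// -leb_splitID.
Qed.

(** * Density points and the I-density *)

Definition interval_at (R : realType) (x h : R) (J : set R) : Prop :=
  [/\ closed J, is_interval J, J x & leb J = h%:E].

(** Bounding the measure of the complement, instead of the ratio from below,
    gives a condition that makes sense and is monotone for arbitrary [A],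
    measurable or not. *)
Definition density_point (R : realType) (A : set R) (x : R) : Prop :=
  forall e, 0 < e -> exists2 d, 0 < d & forall J h, interval_at x h J ->
    0 < h < d -> (leb (J `\` A) <= (e * h)%:E)%E.

Lemma interval_at_le (R : realType) (x h y : R) (J : set R) :
  interval_at x h J -> J y -> `|y - x| <= h.
Proof.
move=> [_ iJ Jx lJ] Jy.
have sub u v : J u -> J v -> u <= v -> v - u <= h.
  move=> Ju Jv uv; rewrite -lee_fin -lJ -leb_itvcc//; apply: le_leb => z /=.
  by rewrite in_itv /=; exact: iJ.
rewrite ler_norml; have [xy|/ltW xy] := leP x y.
  by have := sub x y Jx Jy xy; lra.
by have := sub y x Jy Jx xy; lra.
Qed.

Lemma ideal_initial_segment (I : set_system nat) (n : nat) :
  is_ideal I -> admissible I -> I [set k | (k < n)%N].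
Proof.
move=> idI adI; elim: n => [|n IHn].
  by apply: (idealS idI) (adI 0%N) => k.
apply: (idealS idI) (idealU idI IHn (adI n)) => k /=.
by rewrite ltnS leq_eqVlt => /orP[/eqP ->|]; [right|left].
Qed.

(** From left to right, the intervals that witness a failure of ordinary density
    are chosen with the k-th one shorter than 1/(k+1), so that they form one of
    the sequences that the I-density tests. *)
Lemma lower_density1_density_point (R : realType) (I : set_system nat)
    (A : set R) (x : R) :
  is_ideal I -> nontrivial I -> admissible I -> lebesgue_measurable A ->
  lower_density I x A = 1 <-> density_point A x.
Proof.
move=> idI ntI adI mA; rewrite (lower_density1P idI ntI); split => [d1 e e0|dA].
- apply: contrapT => /forall2NP nd.
  have badJ k : exists Jh : set R * R, [/\ interval_at x Jh.2 Jh.1,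
      0 < Jh.2 < k.+1%:R^-1 & (((e * Jh.2)%:E : \bar R) < leb (Jh.1 `\` A))%E].
    have [/(_ (ltac:(by rewrite invr_gt0) : 0 < k.+1%:R^-1 :> R))//|] := nd k.+1%:R^-1.
    move=> /existsNP[J] /existsNP[h] /not_implyP[Jx] /not_implyP[h0] /negP.
    by rewrite -ltNge => Jh; exists (J, h).
  have [f fP] := choice badJ; pose J k := (f k).1.
  have shJ : shrinking_to I x J.
    split=> [k|]; first by have [[]] := fP k.
    apply: (idealS idI) (adI 0%N) => k /=; case.
    by have [[_ _ _ ->] hk _] := fP k; rewrite !lte_fin.
  apply: ntI.2; apply: (idealS idI) (d1 J shJ (1 - e) _); last by lra.
  move=> k _ /=; rewrite /density_ratio.
  have [[_ _ _ Jh] /andP[h0 _]] := fP k.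
  have [r [s [-> -> rs]]] := leb_splitID_fine mA Jh.
  rewrite /J Jh /= lte_fin ltr_pdivrMr// => ?; lra.
- move=> J [Jx IJ] a a1.
  have [d d0 dP] := dA (1 - a) (ltac:(lra)).
  have [N _ NP] := near_infty_natSinv_lt (PosNum d0).
  apply: (idealS idI) (idealU idI IJ (ideal_initial_segment N idI adI)) => k /= ka.
  have [kN|Nk] := ltnP k N; [by right|left => /= /andP[J0 J1]].
  have Jfin : leb (J k) \is a fin_num.
    by rewrite ge0_fin_numE ?leb_ge0// (lt_trans J1) ?ltry.
  have Jh := esym (fineK Jfin).
  move: J0 J1 ka; rewrite /density_ratio.
  set h := fine (leb (J k)) in Jh *.
  have := dP (J k) h; rewrite /interval_at Jh !lte_fin.
  have [r [s [-> -> rs]]] := leb_splitID_fine mA Jh.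
  have [cJ iJ xJ] := Jx k; have /= kd := NP k Nk.
  move=> /(_ (And4 cJ iJ xJ erefl)); rewrite lee_fin => sh h0 h1.
  by rewrite ltr_pdivrMr// => ra; have := sh (introT andP (conj h0 (lt_trans h1 kd))); lra.
Qed.

Lemma density_openP (R : realType) (I : set_system nat) (A : set R) :
  is_ideal I -> nontrivial I -> admissible I ->
  density_open R I A <->
  lebesgue_measurable A /\ forall x, A x -> density_point A x.
Proof.
move=> idI ntI adI; split=> -[mA dA]; split=> // x Ax.
  by apply/(lower_density1_density_point x idI ntI adI mA); exact: dA.
by apply/(lower_density1_density_point x idI ntI adI mA); exact: dA.
Qed.

Lemma open_density_point (R : realType) (U : set R) (x : R) :
  open U -> U x -> density_point U x.
Proof.
move=> oU Ux e e0.
have /nbhs_ballP[d /= d0 dU] : nbhs x U by exact: open_nbhs_nbhs.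
exists d => // J h Jh /andP[h0 hd].
have -> : J `\` U = set0.
  rewrite setD_eq0 => y Jy; apply: dU; rewrite /ball /= distrC.
  exact: le_lt_trans (interval_at_le Jh Jy) hd.
rewrite [leb set0]outer_measure0 lee_fin mulr_ge0// ltW//.
Qed.

Lemma density_pointS (R : realType) (A B : set R) (x : R) :
  A `<=` B -> density_point A x -> density_point B x.
Proof.
move=> AB dA e /dA[d d0 dP]; exists d => // J h Jh hd.
by apply: le_trans (dP J h Jh hd); apply: le_leb => y [Jy nBy]; split=> // /AB.
Qed.

(** * The Lusin-Menchoff theorem *)

(** The complement, inside the interval, of an open set that tightly covers the
    complement of [E]. *)
Lemma closed_inner_approximation (R : realType) (a b e : R) (E : set R) :
  lebesgue_measurable E -> E `<=` [set` `[a, b]] -> 0 < e ->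
  exists C : set R, [/\ closed C, C `<=` E & (leb (E `\` C) <= e%:E)%E].
Proof.
move=> mE Eab e0; set D := [set` `[a, b]]; set B := D `\` E.
have mD : lebesgue_measurable D.
  by apply: borel_lebesgue_measurable; exact: measurable_itv.
have mB : lebesgue_measurable B by exact: measurableD.
have Doo : (leb D < +oo)%E.
  by rewrite [leb D](lebesgue_measure_itv `[a, b]) /=; case: ifP => _; rewrite ltry.
have Bfin : leb B \is a fin_num by apply: leb_sub_finite Doo; exact: subDsetl.
have [U [oU BU Ue]] := outer_measure_open_le B e0.
exists (D `\` U); split.
- rewrite setDE; apply: closedI; first exact: interval_closed.
  by rewrite closedC.
- move=> y [Dy nUy]; apply: contrapT => nEy; apply: nUy; exact: BU.
- apply: (@le_trans _ _ (leb (U `\` B))).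
    apply: le_leb => y [Ey nDUy]; split; last by case.
    by apply: contrapT => nUy; apply: nDUy; split => //; exact: Eab.
  move: Ue; change (leb U <= leb B + e%:E -> leb (U `\` B) <= e%:E)%E.
  rewrite (leb_splitID U mB).
  have -> : U `&` B = B by apply/setIidPr.
  by rewrite leeD2lE.
Qed.

(** Near the points of [X] the set [P] must lose less and less of [E].  With
    closed sets [C n] that increase inside [E] and miss at most measure r_n^2 of
    it, [P] is the set of points that, for each [n], lie in [C n] or within
    distance about r_n of [X].  An interval of length [h] through a point of [X]
    is within distance r_n of [X] as soon as h < r_n, so on it [P] only feels
    the [C n] with r_n <= h; these lose at most r_N^2 <= h^2 for the first
    such index [N], which is negligible compared with [h]. *)
Lemma lusin_menchoff (R : realType) (a b : R) (X E : set R) :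
  closed X -> lebesgue_measurable E -> E `<=` [set` `[a, b]] -> X `<=` E ->
  (forall x, X x -> density_point E x) ->
  exists P : set R, [/\ closed P, X `<=` P, P `<=` E &
    forall x, X x -> density_point P x].
Proof.
move=> cX mE Eab XE dE; pose r n : R := n.+1%:R^-1.
have r0 n : 0 < r n by rewrite invr_gt0.
have [K KP] := choice (fun n =>
  closed_inner_approximation mE Eab (exprn_gt0 2 (r0 n))).
pose C n := \big[setU/set0]_(i < n.+1) K i.
have KC i n : (i <= n)%N -> K i `<=` C n.
  by move=> le_in y Kiy; rewrite /C -bigcup_mkord; exists i.
pose V n := \bigcup_(x in X) ball x (r n).
pose P := \bigcap_n (C n `|` closure (V n)).
exists P; split.
- apply: closed_bigI => n _; apply: closedU; last exact: closed_closure.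
  by apply: closed_bigsetU => i _; have [] := KP i.
- move=> x Xx n _; right; apply: subset_closure; exists x => //.
  exact: ballxx.
- (* A point outside E is outside X, hence at positive distance e from it; it
     would have to be in closure (V n) for every n. *)
  move=> y Py; apply: contrapT => nEy.
  have /closed_openC oX := cX.
  have /nbhs_ballP[e /= e0 eX] : nbhs y (~` X).
    by apply: open_nbhs_nbhs; split; [exact: oX|move=> /XE].
  have [n _ nP] := near_infty_natSinv_lt (PosNum (divr_gt0 e0 (ltr0n R 2))).
  have {nP} /= rn := nP n (leqnn n).
  have [|Vy] := Py n I.
    by rewrite /C -bigcup_mkord => -[i _ Kiy]; apply: nEy; have [_ KE _] := KP i; exact: KE.
  have [z [[x Xx xz] yz]] := Vy _ (nbhsx_ballx y (e / 2) (divr_gt0 e0 (ltr0n R 2))).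
  apply: (eX x) => //; apply: (ball_split yz); apply: ball_sym.
  exact: le_ball (ltW rn) _ xz.
move=> x Xx e e0.
have [d d0 dP] := dE x Xx (e / 2) (divr_gt0 e0 (ltr0n R 2)).
exists (Num.min d (e / 2)); first by rewrite lt_min d0 divr_gt0.
move=> J h Jh /andP[h0]; rewrite lt_min => /andP[hd he].
have [N rN Nmin] : exists2 N, r N <= h & forall n, r n <= h -> (N <= n)%N.
  have exN : exists n, r n <= h.
    have [n _ nP] := near_infty_natSinv_lt (PosNum h0).
    by exists n; apply/ltW/nP => /=.
  by case: (ex_minnP exN) => N rN Nmin; exists N.
have JEP : (leb ((J `&` E) `\` P) <= (r N ^+ 2)%:E)%E.
  have [_ _ KN] := KP N; apply: le_trans KN; apply: le_leb => y [[Jy Ey] nPy].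
  split=> // KNy; apply: nPy => n _; have [rn|hr] := leP (r n) h.
    by left; exact: KC (Nmin n rn) _ KNy.
  right; apply: subset_closure; exists x => //.
  by rewrite /ball /= distrC; apply: le_lt_trans hr; exact: interval_at_le Jh Jy.
have -> : J `\` P = ((J `\` P) `\` E) `|` ((J `\` P) `&` E).
  by rewrite setDE setUC -setIUr setUv setIT.
have -> : e * h = e / 2 * h + e / 2 * h by lra.
rewrite EFinD; apply: le_trans (lebU2 _ _) _; apply: leeD.
  apply: le_trans (dP J h Jh _); last by rewrite h0 hd.
  by apply: le_leb => y [[]].
have -> : (J `\` P) `&` E = (J `&` E) `\` P by rewrite setIAC.
apply: le_trans JEP _; rewrite lee_fin expr2.
have := r0 N; nra.
Qed.

(** Lebesgue's density theorem speaks of balls centred at [x]; an interval of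
    length [h] through [x] lies in the ball of radius [2 * h], which is only four
    times as long, so a loss of [e / 4] there is a loss of at most [e] in the
    interval. *)
Lemma almost_all_density_points (R : realType) (A : set R) : measurable A ->
  exists Z : set R, [/\ measurable Z, leb Z = 0%E &
    forall x, A x -> ~ Z x -> density_point A x].
Proof.
move=> mA; have [Z [mZ Z0 AZ]] := lebesgue_density mA.
exists Z; split=> // x Ax nZx e e0.
have {AZ} Alim : (leb (A `&` ball x r) / leb (ball x r))%E @[r --> 0^'+] -->
    (1%:E : \bar R).
  apply: contrapT => nlim; apply: nZx; apply: AZ => /= h.
  by apply: nlim; move: h; rewrite indicE mem_set.
pose g r := fine (leb (A `&` ball x r) / leb (ball x r)).
have g1 : g r @[r --> 0^'+] --> (1 : R) by exact: (fine_cvg Alim).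
have e4 : 1 - e / 4 < 1 by lra.
have [d /= d0 dP] : \forall r \near 0^'+, 1 - e / 4 < g r.
  by apply: (cvgr_gt _ g1).
exists (d / 2); first by rewrite divr_gt0.
move=> J h Jh /andP[h0 hd].
have JB : J `<=` ball x (2 * h).
  move=> y Jy; rewrite /ball /= distrC.
  by apply: le_lt_trans (interval_at_le Jh Jy) _; lra.
have Bh : leb (ball x (2 * h)) = (4 * h)%:E.
  rewrite [LHS](lebesgue_measure_ball x (ltW (mulr_gt0 (ltr0n R 2) h0))).
  by congr (_%:E); lra.
have [r [s [Br Bs rs]]] :=
  leb_splitID_fine (borel_lebesgue_measurable mA) Bh.
have : 1 - e / 4 < g (2 * h).
  apply: dP => /=; last lra.
  by rewrite sub0r normrN gtr0_norm; lra.
have h40 : 0 < 4 * h by lra.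
rewrite /g setIC Br Bh inver gt_eqF// -EFinM /= ltr_pdivlMr// => gr.
apply: (@le_trans _ _ (leb (ball x (2 * h) `\` A))).
  by apply: le_leb => y [/JB ? ?].
by rewrite Bs lee_fin; lra.
Qed.

(** * The relation interpolated in Urysohn's construction *)

Definition well_inside (R : realType) (X Y : set R) : Prop :=
  [/\ closed X, closed Y, X `<=` Y & forall x, X x -> density_point Y x].

Lemma well_inside_trans (R : realType) (X Y Z : set R) :
  well_inside X Y -> well_inside Y Z -> well_inside X Z.
Proof.
move=> [cX _ XY dX] [_ cZ YZ _]; split=> //; first exact: subset_trans YZ.
by move=> x Xx; exact: density_pointS YZ (dX x Xx).
Qed.

(** The intermediate set comes from the Lusin-Menchoff theorem applied to [X] and
    to [Y] without the null set of its points at which it may fail to have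
    density 1.  The points of [X] have to be put back, as some of them may lie
    in that null set. *)
Lemma well_inside_interpolation (R : realType) (a b : R) (X Y : set R) :
  Y `<=` [set` `[a, b]] -> well_inside X Y ->
  exists P, well_inside X P /\ well_inside P Y.
Proof.
move=> Yab [cX cY XY dX].
have mY := closed_measurable cY; have mX := closed_measurable cX.
have [Z [mZ Z0 YZ]] := almost_all_density_points mY.
pose E := Y `\` Z `|` X.
have mE : lebesgue_measurable E.
  apply: borel_lebesgue_measurable; apply: measurableU => //.
  exact: measurableD.
have EY : E `<=` Y by move=> y [[]|/XY].
have dE x : X x -> density_point E x.
  move=> Xx e e0; have [d d0 dP] := dX x Xx e e0; exists d => // J h Jh hd.
  apply: le_trans (dP J h Jh hd).
  rewrite -[leRHS]adde0 -Z0; apply: le_trans (lebU2 _ _).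
  apply: le_leb => y [Jy nEy]; have [Zy|nZy] := pselect (Z y); [by right|left].
  by split=> // Yy; apply: nEy; left.
have XE : X `<=` E by move=> x Xx; right.
have [P [cP XP PE dP]] := lusin_menchoff cX mE (subset_trans EY Yab) XE dE.
exists P; split; split=> //; first exact: subset_trans EY.
by move=> x /PE[[Yx nZx]|]; [exact: YZ|exact: dX].
Qed.

(** * Chains indexed by the dyadic numbers *)

(** [F n k] is attached to the number k / 2^n; the first clause says that it
    depends only on that number. *)
Definition dyadic_chain (R : realType) (F : nat -> nat -> set R) : Prop :=
  (forall n k, F n.+1 k.*2 = F n k) /\
  (forall n k, well_inside (F n k.+1) (F n k)).

Lemma exists_dyadic_chain (R : realType) (a b : R) (X Y : set R) :
  Y `<=` [set` `[a, b]] -> well_inside X Y ->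
  exists F : nat -> nat -> set R, [/\ F 0%N 0%N = Y, F 0%N 1%N = X & dyadic_chain F].
Proof.
move=> Yab XY; have [cX cY sXY _] := XY.
have /choice[f fP] (p : set R * set R) : exists Q,
    p.2 `<=` [set` `[a, b]] -> well_inside p.1 p.2 ->
    well_inside p.1 Q /\ well_inside Q p.2.
  have [h|nh] := pselect (p.2 `<=` [set` `[a, b]] /\ well_inside p.1 p.2).
    by have [Q hQ] := well_inside_interpolation h.1 h.2; exists Q.
  by exists set0 => pab wp; case: nh.
(* At level 0 the indices k > 1 carry the empty set, which is well inside every
   closed set; so the recursion needs no bound on k. *)
pose F := fix F n k := if n is n'.+1 then
  if odd k then f (F n' k./2.+1, F n' k./2) else F n' k./2
  else nth set0 [:: Y; X] k.
have Fev n k : F n.+1 k.*2 = F n k by rewrite /= odd_double doubleK.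
have Fod n k : F n.+1 k.*2.+1 = f (F n k.+1, F n k).
  by rewrite /= odd_double /= uphalf_double.
have FP n : (forall k, well_inside (F n k.+1) (F n k)) /\
            (forall k, F n k `<=` [set` `[a, b]]).
  elim: n => [|n [IHw IHs]].
    split=> -[|[|k]] //=; try exact: subset_trans Yab.
    - by split=> //; exact: closed0.
    - by rewrite !nth_nil; split=> //; exact: closed0.
    - by rewrite nth_nil.
  have fw k := fP (F n k.+1, F n k) (IHs k) (IHw k).
  split=> k; rewrite -(odd_double_half k); case: (odd k); rewrite ?add0n ?add1n.
  - by rewrite -doubleS Fev Fod; have [] := fw k./2.
  - by rewrite Fev Fod; have [] := fw k./2.
  - rewrite Fod; have [_ [_ _ + _]] := fw k./2.
    by move=> /subset_trans; apply; exact: IHs.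
  - by rewrite Fev.
by exists F; split=> //; split=> // n k; have [] := FP n.
Qed.

Definition dyadic (R : realType) (n k : nat) : R := k%:R / 2 ^+ n.

Lemma dyadic_between (R : realType) (c d : R) : 0 <= c -> c < d ->
  exists n k, c < dyadic R n k < d.
Proof.
move=> c0 cd; have dc0 : 0 < d - c by lra.
have [n _ nP] := near_infty_natSinv_lt (PosNum dc0).
have /= {nP} nd := nP n (leqnn n).
have p0 : 0 < 2 ^+ n :> R by rewrite exprn_gt0.
have pd : 1 < (d - c) * 2 ^+ n.
  rewrite -ltr_pdivrMr// div1r; apply: le_lt_trans nd.
  by rewrite lef_pV2 ?posrE// -natrX ler_nat ltn_expl.
have cp0 : 0 <= c * 2 ^+ n by rewrite mulr_ge0// ltW.
have /andP[tl tr] := truncn_itv cp0.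
exists n, (Num.truncn (c * 2 ^+ n)).+1.
rewrite /dyadic ltr_pdivlMr// ltr_pdivrMr// tr /=.
by rewrite -natr1; lra.
Qed.

(** The element 0 keeps the set nonempty at the points that lie in no [F n k], so
    that the general facts on suprema hold at every point. *)
Definition dyadic_levels (R : realType) (F : nat -> nat -> set R) (x : R) :
    set R :=
  0 |` [set dyadic R nk.1 nk.2 | nk in
         [set nk : nat * nat | (nk.2 <= 2 ^ nk.1)%N /\ F nk.1 nk.2 x]].

Definition dyadic_height (R : realType) (F : nat -> nat -> set R) (x : R) : R :=
  sup (dyadic_levels F x).

Lemma dyadic_le1 (R : realType) (n k : nat) : (k <= 2 ^ n)%N -> dyadic R n k <= 1.
Proof.
by move=> kn; rewrite /dyadic ler_pdivrMr ?exprn_gt0// mul1r -natrX ler_nat.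
Qed.

Lemma dyadic_levels_ubound (R : realType) (F : nat -> nat -> set R) (x : R) :
  ubound (dyadic_levels F x) 1.
Proof. by move=> _ [->//|[nk [nk1 _] <-]]; exact: dyadic_le1. Qed.

Lemma dyadic_height_ge0 (R : realType) (F : nat -> nat -> set R) (x : R) :
  0 <= dyadic_height F x.
Proof.
by apply: ub_le_sup; [exists 1; exact: dyadic_levels_ubound|left].
Qed.

Lemma dyadic_height_le1 (R : realType) (F : nat -> nat -> set R) (x : R) :
  dyadic_height F x <= 1.
Proof. by apply: ge_sup; [exists 0; left|exact: dyadic_levels_ubound]. Qed.

Lemma le_dyadic_height (R : realType) (F : nat -> nat -> set R) (x : R) n k :
  (k <= 2 ^ n)%N -> F n k x -> dyadic R n k <= dyadic_height F x.
Proof.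
move=> kn Fx; apply: ub_le_sup; first by exists 1; exact: dyadic_levels_ubound.
by right; exists (n, k).
Qed.

Lemma dyadic_height_gt (R : realType) (F : nat -> nat -> set R) (c x : R) :
  0 <= c -> c < dyadic_height F x ->
  exists n k, [/\ (k <= 2 ^ n)%N, F n k x & c < dyadic R n k].
Proof.
move=> c0 /sup_gt[|t [->|[[n k] /= [kn Fx] <-]] ct]; first by exists 0; left.
  by move: c0; rewrite leNgt ct.
by exists n, k.
Qed.

(** Both sets are members of the common level n + m of the chain, where the
    larger number has the larger index. *)
Lemma dyadic_chain_lt (R : realType) (F : nat -> nat -> set R) n k m l :
  dyadic_chain F -> dyadic R n k < dyadic R m l -> well_inside (F m l) (F n k).
Proof.
move=> [Fdouble Fwi] kl.
have refine i j p : F i j = F (i + p)%N (j * 2 ^ p)%N.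
  elim: p => [|p IHp]; first by rewrite addn0 muln1.
  by rewrite addnS expnSr mulnA muln2 Fdouble.
have level i j j' : (j < j')%N -> well_inside (F i j') (F i j).
  elim: j' => // j' IH; rewrite ltnS leq_eqVlt => /predU1P[->//|/IH].
  exact: well_inside_trans.
rewrite (refine n k m) (refine m l n) (addnC m); apply: level.
move: kl; rewrite /dyadic ltr_pdivlMr ?exprn_gt0// mulrAC.
by rewrite ltr_pdivrMr ?exprn_gt0// -!natrX -!natrM ltr_nat.
Qed.

(** * Continuity of the height *)

(** If c < l / 2^m < k / 2^n and [x] is in [F n k], then [F m l] has density 1
    at [x], and it lies in the level set because l / 2^m is above c. *)
Lemma dyadic_height_gt_density (R : realType) (F : nat -> nat -> set R) (c : R) :
  dyadic_chain F ->
  lebesgue_measurable [set x | c < dyadic_height F x] /\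
  forall x, c < dyadic_height F x ->
    density_point [set y | c < dyadic_height F y] x.
Proof.
move=> Fchain.
have cF n k : closed (F n k) by have [] := Fchain.2 n k.
have [c0|c0] := ltP c 0.
  have -> : [set x | c < dyadic_height F x] = setT.
    by apply/seteqP; split=> // x _ /=; apply: lt_le_trans (dyadic_height_ge0 _ _).
  split=> [|x _]; first exact: measurableT.
  by apply: open_density_point; [exact: openT|].
split=> [|x /(dyadic_height_gt c0)[n [k [kn Fx ck]]]].
  have -> : [set x | c < dyadic_height F x] = \bigcup_n
      \bigcup_(k in [set k | (k <= 2 ^ n)%N /\ c < dyadic R n k]) F n k.
    apply/seteqP; split=> x /=.
      by move=> /(dyadic_height_gt c0)[n [k [kn Fx ck]]]; exists n => //; exists k.
    by move=> [n _ [k [kn ck] Fx]]; apply: lt_le_trans ck (le_dyadic_height kn Fx).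
  apply: borel_lebesgue_measurable; apply: bigcupT_measurable => n.
  by apply: bigcup_measurable => k _; exact: closed_measurable.
have [m [l /andP[cl lk]]] := dyadic_between c0 ck.
have [_ _ _ dF] := dyadic_chain_lt Fchain lk.
apply: density_pointS (dF x Fx) => y Fy /=.
apply: lt_le_trans cl (le_dyadic_height _ Fy).
have := le_trans (ltW lk) (dyadic_le1 R kn).
by rewrite /dyadic ler_pdivrMr ?exprn_gt0// mul1r -natrX ler_nat.
Qed.

(** If the height of [x] is below a dyadic number l / 2^m < c, then [x] is outside
    the closed set [F m l], and the height is at most l / 2^m off that set. *)
Lemma open_dyadic_height_lt (R : realType) (F : nat -> nat -> set R) (c : R) :
  dyadic_chain F ->
  open [set x | dyadic_height F x < c].
Proof.
move=> Fchain; rewrite openE => x /= gx.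
have [m [l /andP[gl lc]]] := dyadic_between (dyadic_height_ge0 F x) gx.
(* Numbers l / 2^m above 1 do not enter the height, which is then below c
   everywhere. *)
have [l1|l1] := leqP l (2 ^ m); last first.
  apply: filterE => y /=; apply: le_lt_trans (dyadic_height_le1 _ _) _.
  apply: lt_trans lc; rewrite /dyadic ltr_pdivlMr ?exprn_gt0// mul1r.
  by rewrite -natrX ltr_nat.
have nFx : ~ F m l x by move=> /(le_dyadic_height l1); rewrite leNgt gl.
have : nbhs x (~` F m l).
  apply: open_nbhs_nbhs; split=> //; rewrite openC.
  by have [] := Fchain.2 m l.
apply: filterS => y nFy /=; rewrite ltNge; apply/negP.
move=> /(lt_le_trans lc)/(dyadic_height_gt _)[|n [k [kn Fy lk]]].
  by rewrite /dyadic divr_ge0// exprn_ge0.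
by apply: nFy; have [_ _ + _] := dyadic_chain_lt Fchain lk; apply.
Qed.

Theorem theorem7p4 (R : realType) (I : set_system nat)
  (idI : is_ideal I) (ntI : nontrivial I) (adI : admissible I) :
  completely_regular R (density_space R idI ntI adI).
Proof.
move=> C p0 cC nCp0.
have oA : density_open R I (~` C) by move: cC; rewrite -openC.
have [mA dA] := (density_openP _ idI ntI adI).1 oA.
(* Intersecting with a ball gives the bounded set that [lusin_menchoff] asks
   for. *)
pose B : set R := ball (p0 : R) 1.
have mB : lebesgue_measurable B.
  by apply: borel_lebesgue_measurable; apply: open_measurable; exact: ball_open.
have Bp0 : B p0 by exact: ballxx.
have oB : density_open R I B.
  apply/(density_openP _ idI ntI adI); split=> // x; apply: open_density_point.
  exact: ball_open.
have [mE dE] := (density_openP _ idI ntI adI).1 (density_openI idI ntI oA oB).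
have Eab : ~` C `&` B `<=` [set` `[(p0 : R) - 1, p0 + 1]].
  move=> x [_]; rewrite /B /ball /= in_itv /= ltr_distlC => /andP[? ?].
  by apply/andP; split; lra.
have pE : [set (p0 : R)] `<=` ~` C `&` B by move=> _ ->.
have cp : closed [set (p0 : R)].
  exact/accessible_closed_set1/hausdorff_accessible/Rhausdorff.
have [P [cP pP PE dP]] := lusin_menchoff cp mE Eab pE
  (fun x px => dE x (pE x px)).
have pP' : well_inside [set (p0 : R)] P by split=> //; exact: cp.
have [F [F0 F1 Fchain]] := exists_dyadic_chain (subset_trans PE Eab) pP'.
exists (dyadic_height F); split.
- move=> x; apply/(@cvgrPdist_lt _ _ _ (nbhs x) (nbhs_filter x)) => e e0.
  have near_x (U : set (density_space R idI ntI adI)) :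
      density_open R I U -> U x -> nbhs x U.
    by move=> oU Ux; apply: open_nbhs_nbhs; split.
  have gt_x : nbhs x [set y | dyadic_height F x - e < dyadic_height F y].
    apply: near_x; last by rewrite /=; lra.
    apply/(density_openP _ idI ntI adI).
    exact: dyadic_height_gt_density.
  have lt_x : nbhs x [set y | dyadic_height F y < dyadic_height F x + e].
    apply: near_x; last by rewrite /=; lra.
    have oU := @open_dyadic_height_lt _ _ (dyadic_height F x + e) Fchain.
    apply/(density_openP _ idI ntI adI); split.
      by apply: borel_lebesgue_measurable; exact: open_measurable.
    by move=> y; apply: open_density_point.
  apply: (@filterS2 _ (nbhs x) (nbhs_filter x) _ _ _ _ gt_x lt_x) => y /= gy ly.
  by rewrite ltr_norml; lra.
- by move=> x; rewrite dyadic_height_ge0 dyadic_height_le1.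
- move=> x Cx; apply: le_anti; rewrite dyadic_height_ge0 andbT leNgt.
  apply/negP => /(dyadic_height_gt (lexx 0))[n [k [_ Fx k0]]].
  have FP : F n k `<=` F 0%N 0%N.
    have [] := @dyadic_chain_lt _ F 0 0 n k Fchain => //.
    by rewrite {1}/dyadic mul0r.
  by have /PE[] : P x by rewrite -F0; exact: FP.
- apply: le_anti; rewrite dyadic_height_le1 /=.
  have -> : 1 = dyadic R 0 1 by rewrite /dyadic expr0 divr1.
  by apply: le_dyadic_height; rewrite ?F1.
Qed.
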